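(* Let $\Lambda$ be a finite box of a $d$-dimensional lattice (for instance $\mathbb{Z}^d$), let $\beta>0$, $\Delta\ge 0$ and $\Gamma>0$, and consider the random Hamiltonian on spin configurations $\sigma\in\{-1,1\}^\Lambda$ $$H_\Lambda(\sigma) = -\sum_{\substack{i,j\in\Lambda\\ |i-j|=1}} J_{i,j}\,\sigma_i\sigma_j-\sum_{i\in\Lambda}h_i\sigma_i ,$$ where the $J_{i,j}$ are i.i.d. centered Gaussian random variables with variance $\Delta^2$, the $h_i$ are i.i.d. centered Gaussian random variables with variance $\Gamma^2$, and the families $(h_i)$ and $(J_{i,j})$ are mutually independent. Let $\omega$ denote the random Boltzmann-Gibbs expectation at inverse temperature $\beta$ and $\mathrm{Av}$ the expectation over the Gaussian variables. Then for all $m\in\Lambda$ and $n\in\Lambda$, independently of their distance, $$\mathrm{Av}\left(\omega^2(\sigma_m\sigma_n)\right)\;\ge\; 1-\frac{s_1}{\beta}-\frac{s_3}{\beta^3},\qquad\text{where}\quad s_1=\frac{2}{\Gamma}\sqrt{\frac{2}{\pi}},\quad s_3=\frac{1}{\sqrt{2\pi}\,\Gamma^3}.$$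
   Context: Here $|i-j|=1$ means that $i$ and $j$ are nearest neighbours in the lattice; each nearest-neighbour bond $\{i,j\}$ carries one coupling $J_{i,j}$ and contributes one term to the sum. A Gaussian variable of variance $0$ is identically $0$. For a function $f$ of the spin configuration and a given realization of the couplings, $\omega(f)=\dfrac{\sum_{\sigma} f(\sigma)e^{-\beta H_\Lambda(\sigma)}}{\sum_{\sigma}e^{-\beta H_\Lambda(\sigma)}}$, the sums running over $\sigma\in\{-1,1\}^\Lambda$; $\omega^2(f)$ means $(\omega(f))^2$. *)

(* Defs.v *)
From mathcomp Require Import all_boot all_order all_algebra finmap.
From mathcomp Require Import all_classical all_reals all_analysis.

Set Implicit Arguments.
Unset Strict Implicit.
Unset Printing Implicit Defensive.
Import Order.TTheory GRing.Theory Num.Theory.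
Import numFieldNormedType.Exports.

Local Open Scope classical_set_scope.
Local Open Scope ring_scope.

Section Lattice.
Context {R : realType} {d : nat}.

(* The canonical norm on ['rV[R]_d] is the sup norm, for which diagonal
   neighbours of Z^d would also be at distance 1. *)
Definition euclid_norm (x : 'rV[R]_d) : R := Num.sqrt (\sum_k x 0 k ^+ 2).

Definition lattice_point (B : 'M[R]_d) (z : 'rV[int]_d) : 'rV[R]_d :=
  map_mx intr z *m B.

(* The lattice spanned over Z by the rows of B; [lattice 1%:M] is Z^d. *)
Definition lattice (B : 'M[R]_d) : set 'rV[R]_d := range (lattice_point B).

(* A lattice normalised in this way has |x - y| = 1 only for nearest
   neighbours. *)
Definition unit_spacing (L : set 'rV[R]_d) : Prop :=
  forall x y, L x -> L y -> x != y -> 1 <= euclid_norm (x - y).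

Definition lattice_box (B : 'M[R]_d) (a b : 'rV[int]_d) : set 'rV[R]_d :=
  lattice_point B @` [set z : 'rV[int]_d | forall k, a 0 k <= z 0 k <= b 0 k].

Definition nearest_neighbours (x y : 'rV[R]_d) : bool :=
  euclid_norm (x - y) == 1.

(* Bonds are unordered pairs, so that each of them carries a single coupling
   and contributes a single term to the Hamiltonian. *)
Definition is_bond (Lam : {fset 'rV[R]_d}) : pred {set Lam} :=
  [pred e | [exists i : Lam, exists j : Lam,
     nearest_neighbours (val i) (val j) && (e == [set i; j]%SET)]].

End Lattice.

Notation bond Lam := {e : {set Lam} | is_bond e}.

Section IsingModel.
Context {R : realType} {d : nat} {Lam : {fset 'rV[R]_d}}.

(* Spins are encoded by booleans: [true] stands for 1, [false] for -1. *)
Notation config := {ffun Lam -> bool}.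

Definition spin (s : config) (i : Lam) : R := if s i then 1 else -1.

(* The product over a bond {i, j} has the two factors at i and at j. *)
Definition hamiltonian (J : bond Lam -> R) (h : Lam -> R) (s : config) : R :=
  - (\sum_(e : bond Lam) J e * \prod_(i in \val e) spin s i)
  - \sum_(i : Lam) h i * spin s i.

Definition gibbs (beta : R) (J : bond Lam -> R) (h : Lam -> R)
    (f : config -> R) : R :=
  (\sum_(s : config) f s * expR (- beta * hamiltonian J h s)) /
  (\sum_(s : config) expR (- beta * hamiltonian J h s)).

End IsingModel.

Section Probability.
Context {disp : measure_display} {T : measurableType disp} {R : realType}.
Variable P : probability T R.

(* The case distinction is needed because [normal_prob 0 0] is, by convention,
   the uniform law on [0, 1]. *)
Definition centered_gaussian (s : R) (X : {RV P >-> R}) : Prop :=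
  forall A : set R, measurable A ->
    distribution P X A = if s == 0 then \d_(0 : R) A else normal_prob 0 s A.

Definition mutually_independent (I : finType) (X : I -> {RV P >-> R}) : Prop :=
  forall (S : {set I}) (A : I -> set R), (forall i, measurable (A i)) ->
    P (\bigcap_(i in [set` S]) X i @^-1` A i) =
    (\prod_(i in S) P (X i @^-1` A i))%E.

Definition sigma_generated (I : finType) (X : I -> {RV P >-> R}) :
    set (set T) :=
  <<s [set E | exists i A, measurable A /\ E = X i @^-1` A] >>.

Definition independent_families (I K : finType)
    (X : I -> {RV P >-> R}) (Y : K -> {RV P >-> R}) : Prop :=
  forall E F, sigma_generated X E -> sigma_generated Y F ->
    P (E `&` F) = (P E * P F)%E.

End Probability.

(* Main.v *)
(** The cubic term of the bound is not needed.  The spins take values [1] and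
    [-1], so positivity of [omega] on the four products
    [(1 +- sigma_m) (1 +- sigma_n)] gives
    [1 - omega^2(sigma_m sigma_n) <=
     (1 - omega^2(sigma_m)) + (1 - omega^2(sigma_n))].
    As a function of [h_m] alone, [omega(sigma_m) = tanh (beta h_m + c)] with
    [c] determined by the other fields and the couplings, hence independent of
    [h_m].  The density of [h_m] is at most [1 / (Gamma sqrt (2 pi))] and
    [1 - tanh^2 (beta x + c)] integrates to [2 / beta] over the line, so
    [Av (1 - omega^2(sigma_m)) <= sqrt (2 / pi) / (beta Gamma)], which is
    [s1 / (2 beta)]. *)
Require Import Defs.
From mathcomp Require Import all_boot all_order all_algebra finmap.
From mathcomp Require Import all_classical all_reals all_analysis.
From mathcomp Require Import measurable_realfun ring lra.
Import Order.TTheory GRing.Theory Num.Theory.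
Import numFieldNormedType.Exports.
Local Open Scope classical_set_scope.
Local Open Scope ring_scope.

(** * Integrals over the whole real line *)

Lemma ge0_integralT_FTC (R : realType) (f F : R -> R) (l0 l1 : R) :
  (forall x, 0 <= f x) -> continuous f ->
  (forall x, is_derive x (1 : R) F (f x)) ->
  F (- x) @[x --> +oo] --> l0 -> F x @[x --> +oo] --> l1 ->
  (\int[lebesgue_measure]_x (f x)%:E = (l1 - l0)%:E)%E.
Proof.
move=> f0 cf dF Fl0 Fl1.
have cF : continuous F.
  by move=> x; apply/differentiable_continuous/derivable1_diffP; case: (dF x).
have dFN (x : R) : is_derive x (1 : R) (- (F \o -%R)) (f (- x)).
  have /= dFo :=
    @is_derive1_comp R F (@GRing.opp R) x (f (- x)) (- 1) (dF (- x)) _.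
  apply: is_derive_eq.
  by rewrite mulrN1 opprK.
have mf : measurable_fun [set: R] f by exact: continuous_measurable_fun.
have mposnums : measurable [set x : R | 0 <= x] by rewrite -set_itvcy.
(* The line is cut at 0. The substitution of [- x] for [x] turns the negative part into a second
   positive half-line, so the fundamental theorem of calculus serves twice and the two values of [F]
   at 0 cancel. *)
rewrite -(setUv [set x : R | 0 <= x]) ge0_integral_setU//= ; last 4 first.
- exact: measurableC.
- by apply/measurable_EFinP; rewrite setUv.
- by move=> x _; rewrite lee_fin.
- exact/disj_setPCl.
rewrite -set_itvcy// setCitvr.
rewrite integral_itv_bndo_bndc; last exact/measurable_EFinP/measurable_funTS.
rewrite -{2}oppr0 ge0_integration_by_substitutionNy//; last first.
  exact: continuous_subspaceT.
rewrite (@ge0_continuous_FTC2y _ f F _ l1)//; last 3 first.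
- exact: continuous_subspaceT.
- by apply: cvg_at_right_filter; exact: cF.
- by move=> x _; rewrite derive1E derive_val.
have cfN : continuous (f \o -%R).
  by move=> x; apply: continuous_comp; [exact: opp_continuous|exact: cf].
have cFN : continuous (- (F \o -%R)).
  by move=> x; apply/differentiable_continuous/derivable1_diffP; case: (dFN x).
rewrite (@ge0_continuous_FTC2y _ (f \o -%R) (- (F \o -%R)) _ (- l0));
  last 6 first.
- by move=> x _ /=.
- exact: continuous_subspaceT.
- exact: cvgN.
- by move=> x _; have [] := dFN x.
- by apply: cvg_at_right_filter; exact: cFN.
- by move=> x _; rewrite derive1E derive_val.
by rewrite -!EFinB -EFinD; congr EFin; rewrite !fctE oppr0; ring.
Qed.

(* The function [1 - tanh^2 (u / 2)], that is, the variance of a +-1 variable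
   of log-odds [u]. *)
Definition logistic_variance (R : realType) (u : R) : R :=
  4 * expR u / (1 + expR u) ^+ 2.

Lemma logistic_variance_ge0 (R : realType) (u : R) : 0 <= logistic_variance R u.
Proof. by rewrite divr_ge0 ?sqr_ge0// mulr_ge0// expR_ge0. Qed.

Lemma continuous_logistic_variance (R : realType) :
  continuous (logistic_variance R).
Proof.
move=> u; apply: cvgM.
  by apply: cvgM; [exact: cvg_cst|exact: continuous_expR].
apply: cvgV; first by rewrite expf_neq0// gt_eqF// addr_gt0// expR_gt0.
apply: (cvg_comp (fun x => 1 + expR x) (fun x => x ^+ 2)).
  by apply: cvgD; [exact: cvg_cst|exact: continuous_expR].
exact: exprn_continuous.
Qed.

Lemma integral_logistic_variance (R : realType) (beta c : R) : 0 < beta ->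
  (\int[lebesgue_measure]_x (logistic_variance R (c - 2 * beta * x))%:E
   = (2 / beta)%:E)%E.
Proof.
(* The antiderivative is a scaled logistic function, which rises from 0 at minus infinity to
   [2 / beta] at plus infinity. *)
move=> b0; pose F (x : R) := 2 / beta * (1 + expR (c - 2 * beta * x))^-1.
have pos (x : R) : 0 < 1 + expR (c - 2 * beta * x).
  by rewrite addr_gt0// expR_gt0.
have exp0 : expR (- (2 * beta * x)) @[x --> +oo] --> 0.
  apply: (cvg_comp (fun x => 2 * beta * x) (fun x => expR (- x))); last first.
    exact: cvgr_expR.
  by apply: gt0_cvgMry; [rewrite mulr_gt0|exact: cvg_id].
rewrite -[2 / beta]subr0.
apply: (ge0_integralT_FTC R (fun x => logistic_variance R _) F).
- by move=> x; exact: logistic_variance_ge0.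
- move=> x; apply: (cvg_comp (fun x => c - 2 * beta * x)).
    apply: cvgB; [exact: cvg_cst|apply: cvgM; [exact: cvg_cst|exact: cvg_id]].
  exact: continuous_logistic_variance.
- move=> x.
  have dg : is_derive x (1 : R) (fun x : R => 1 + expR (c - 2 * beta * x))
     (- (2 * beta) * expR (c - 2 * beta * x)).
    have d1 : is_derive x (1 : R) (fun x : R => c - 2 * beta * x)
        (- (2 * beta)).
      by apply: is_derive_eq; rewrite /GRing.scale/= ?mulr1; ring.
    have d2 := @is_derive1_comp R expR _ x _ _ (is_derive_expR _) d1.
    apply: is_derive_eq.
    by rewrite add0r mul1r mulrC.
  have dV := realfun.is_deriveV (f := fun x => 1 + expR (c - 2 * beta * x))
    (lt0r_neq0 (pos x)) dg.
  rewrite /F.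
  apply: is_derive_eq.
  rewrite /logistic_variance /GRing.scale/=.
  have := lt0r_neq0 (pos x); move: (expR _) => e e0.
  by field; rewrite e0 gt_eqF.
- rewrite -[X in _ --> X](mulr0 (2 / beta)); apply: cvgM; first exact: cvg_cst.
  (* At [- x] the exponential diverges. Dividing numerator and denominator by it leaves only terms
     that tend to 0 or are constant. *)
  have -> : (fun x => (1 + expR (c - 2 * beta * - x))^-1) =
      (fun x => expR (- c) * expR (- (2 * beta * x)) /
                (1 + expR (- c) * expR (- (2 * beta * x)))).
    apply/funext => x; rewrite -expRD mulrN opprK -opprD expRN.
    by field; rewrite addr_eq0 -addr_eq0 !gt_eqF ?addr_gt0 ?expR_gt0.
  rewrite -[X in _ --> X](mul0r (1 + 0)^-1).
  have h0 : expR (- c) * expR (- (2 * beta * x)) @[x --> +oo] --> 0.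
    rewrite -[X in _ --> X](mulr0 (expR (- c))).
    by apply: cvgM; [exact: cvg_cst|exact: exp0].
  apply: cvgM => //; apply: cvgV; first by rewrite addr0 oner_neq0.
  by apply: cvgD => //; exact: cvg_cst.
- rewrite [X in _ --> X](_ : _ = 2 / beta * (1 + 0)^-1); last first.
    by rewrite addr0 invr1 mulr1.
  apply: cvgM; first exact: cvg_cst.
  apply: cvgV; first by rewrite addr0 oner_neq0.
  apply: cvgD; first exact: cvg_cst.
  rewrite -[X in _ --> X](mulr0 (expR c)).
  under eq_fun do rewrite expRD.
  by apply: cvgM; [exact: cvg_cst|exact: exp0].
Qed.

Lemma measurable_logistic_variance (R : realType) :
  measurable_fun [set: R] (logistic_variance R).
Proof. exact: continuous_measurable_fun (@continuous_logistic_variance R). Qed.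

(** * Averaging over one independent Gaussian variable *)

(** Independence on rectangles makes the joint law of [Y] and [X] the product of their laws. Tonelli
    then integrates over [X] with [Y] frozen, and averaging over the probability law of [Y]
    preserves the uniform bound [K]. *)
Lemma ge0_integral_indep_le (d d1 d2 : measure_display)
    (T : measurableType d) (T1 : measurableType d1) (T2 : measurableType d2)
    (R : realType) (P : probability T R)
    (Y : {RV P >-> T1}) (X : {RV P >-> T2}) (g : T1 * T2 -> R) (K : R) :
  (forall A B, measurable A -> measurable B ->
    P (Y @^-1` A `&` X @^-1` B) = (P (Y @^-1` A) * P (X @^-1` B))%E) ->
  measurable_fun setT g -> (forall z, 0 <= g z) ->
  (forall y, \int[distribution P X]_x (g (y, x))%:E <= K%:E)%E ->
  (\int[P]_w (g (Y w, X w))%:E <= K%:E)%E.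
Proof.
move=> XY mg g0 gK.
have K0 : (0 <= K%:E)%E.
  by apply: le_trans (gK point); apply: integral_ge0 => x _; rewrite lee_fin.
have mYX : measurable_fun [set: T] (fun w => (Y w, X w)).
  by apply: measurable_fun_pair; exact: measurable_funP.
pose YX : {mfun T >-> (T1 * T2)%type} := mfun_Sub (mem_set mYX).
have mg' : measurable_fun setT (EFin \o g) by exact/measurable_EFinP.
have -> : (\int[P]_w (g (Y w, X w))%:E = \int[distribution P YX]_z (g z)%:E)%E.
  by rewrite ge0_integral_distribution//= => z; rewrite lee_fin.
rewrite (eq_measure_integral (distribution P Y \x distribution P X)%E);
  last first.
  by move=> A mA _; apply/esym/product_measure_unique.
rewrite fubini_tonelli1//=.
apply: (@le_trans _ _ (\int[distribution P Y]_y (cst K%:E) y)%E).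
  apply: ge0_le_integral => //.
  - by move=> y _; apply: integral_ge0 => x _; rewrite lee_fin.
  - exact: measurable_fun_fubini_tonelli_F.
  - by move=> y _; exact: gK.
by rewrite integral_cst// -[leRHS]mule1 lee_wpmul2l//; exact: probability_le1.
Qed.

(** The Gaussian density never exceeds its peak, so the normal law is dominated by
    [normal_peak Gamma] times Lebesgue measure. The resulting bound is uniform in [c]. *)
Lemma normal_integral_logistic_variance_le (R : realType) (beta Gamma c : R) :
  0 < beta -> 0 < Gamma ->
  (\int[normal_prob 0 Gamma]_x (logistic_variance R (c - 2 * beta * x))%:E
    <= (normal_peak Gamma * (2 / beta))%:E)%E.
Proof.
move=> beta0 Gamma0.
have peak0 : (0 <= normal_peak Gamma) by exact: normal_peak_ge0.
have mlv : measurable_fun [set: R]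
    (fun x => (logistic_variance R (c - 2 * beta * x))%:E).
  apply/measurable_EFinP.
  apply: (measurableT_comp (@measurable_logistic_variance R)).
  by apply: measurable_funB => //; exact: measurable_funM.
apply: (@le_trans _ _ (\int[mscale (NngNum peak0) lebesgue_measure]_x
    (logistic_variance R (c - 2 * beta * x))%:E)%E).
  apply: ge0_le_measure_integral => //.
  - move=> A mA.
    rewrite [leRHS](_ : _ = (\int[lebesgue_measure]_(x in A)
      (cst (normal_peak Gamma)%:E) x)%E); last by rewrite integral_cst.
    rewrite /normal_prob.
    apply: ge0_le_integral => //.
    + by move=> x _; rewrite lee_fin normal_pdf_ge0.
    + by apply/measurable_EFinP/measurable_funTS; exact: measurable_normal_pdf.
    + by move=> x _; rewrite lee_fin normal_pdf_ub// gt_eqF.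
  - by move=> x; rewrite lee_fin logistic_variance_ge0.
rewrite ge0_integral_mscale//; last first.
  by move=> x; rewrite lee_fin logistic_variance_ge0.
by rewrite integral_logistic_variance.
Qed.

(** * Independence of one field from the couplings and the other fields *)

(** Naming the generator used in [sigma_generated] lets membership there be read as measurability in
    [g_sigma_algebraType (preimages X)]. *)
Definition preimages {d : measure_display} {T : measurableType d} {R : realType}
    {P : probability T R} {L : Type} (X : L -> {RV P >-> R}) : set (set T) :=
  [set E | exists i A, measurable A /\ E = X i @^-1` A].

Section Independence.
Context {d : measure_display} {T : measurableType d} {R : realType}.
Context {P : probability T R} {I K : finType}.
Variables (J : K -> {RV P >-> R}) (h : I -> {RV P >-> R}).
Hypotheses (h_indep : mutually_independent h).
Hypothesis (Jh_indep : independent_families J h).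

Lemma measurable_RV_preimage (X : {RV P >-> R}) (A : set R) :
  measurable A -> measurable (X @^-1` A).
Proof. by move=> mA; rewrite -[_ @^-1` _]setTI; exact: measurable_funP. Qed.

Lemma sigma_generated_measurable (E : set T) :
  sigma_generated J E -> measurable E.
Proof.
apply: smallest_sub; first exact: sigma_algebra_measurable.
by move=> _ [k [A [mA ->]]]; exact: measurable_RV_preimage.
Qed.

Lemma sigma_generated_bigcap (S : {set I}) (A : I -> set R) :
  (forall i, measurable (A i)) ->
  sigma_generated h (\bigcap_(i in [set` S]) h i @^-1` A i).
Proof.
move=> mA; apply: (@fin_bigcap_measurable _ (g_sigma_algebraType (preimages h))
  _ [set` S] (fun i => h i @^-1` A i)).
  exact: finite_finset.
by move=> i _; apply: sub_sigma_algebra; exists i, (A i).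
Qed.

Lemma indep_rectangle (F : set T) (S : {set I}) (A : I -> set R) :
  sigma_generated J F -> (forall i, measurable (A i)) ->
  P (F `&` \bigcap_(i in [set` S]) h i @^-1` A i) =
  (P F * \prod_(i in S) P (h i @^-1` A i))%E.
Proof.
move=> JF mA; rewrite Jh_indep//; last exact: sigma_generated_bigcap.
by rewrite h_indep.
Qed.

(* A pi-system generating the sigma-algebra of all the [J k] and of the [h i]
   with [i != i0]. *)
Definition off_site (i0 : I) : set (set T) :=
  [set E | exists F A, [/\ sigma_generated J F, forall i, measurable (A i) &
    E = F `&` \bigcap_(i in [set` [set~ i0]%SET]) h i @^-1` A i]].

Lemma off_site_measurable (i0 : I) : off_site i0 `<=` measurable.
Proof.
move=> _ [F [A [JF mA ->]]]; apply: measurableI.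
  exact: sigma_generated_measurable.
apply: fin_bigcap_measurable => [|i _]; first exact: finite_finset.
exact: measurable_RV_preimage.
Qed.

Lemma off_site_setI (i0 : I) : setI_closed (off_site i0).
Proof.
move=> _ _ [F [A [JF mA ->]]] [F' [A' [JF' mA' ->]]].
exists (F `&` F'), (fun i => A i `&` A' i); split.
- exact: (@measurableI _ (g_sigma_algebraType (preimages J))).
- by move=> i; exact: measurableI.
- by rewrite setIACA -bigcapI.
Qed.

Lemma off_site_setT (i0 : I) : off_site i0 setT.
Proof.
exists setT, (fun=> setT); split => //.
- exact: (@measurableT _ (g_sigma_algebraType (preimages J))).
- by apply/seteqP; split.
Qed.

Lemma off_site_measurable_coupling (i0 : I) (k : K) :
  measurable_fun [set: g_sigma_algebraType (off_site i0)]
    (J k : g_sigma_algebraType (off_site i0) -> R).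
Proof.
move=> _ A mA; rewrite setTI; apply: sub_sigma_algebra.
exists (J k @^-1` A), (fun=> setT); split => //.
  by apply: sub_sigma_algebra; exists k, A.
by rewrite [X in _ `&` X](_ : _ = setT) ?setIT//; apply/seteqP; split.
Qed.

Lemma off_site_measurable_field (i0 i : I) : i != i0 ->
  measurable_fun [set: g_sigma_algebraType (off_site i0)]
    (h i : g_sigma_algebraType (off_site i0) -> R).
Proof.
move=> ii0 _ A mA; rewrite setTI; apply: sub_sigma_algebra.
exists setT, (fun j => if j == i then A else setT); split.
- exact: (@measurableT _ (g_sigma_algebraType (preimages J))).
- by move=> j; case: ifP.
- rewrite setTI; apply/seteqP; split => x /=.
    by move=> Ax j _ /=; case: eqP => // ->.
  by move=> /(_ i); rewrite /= eqxx in_setC1; exact.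
Qed.

(** As functions of [E], both sides are finite measures: [P] restricted to the event that [h i0]
    lies in [B], and [P] scaled by the probability of that event. They agree on the pi-system
    [off_site i0], hence on the sigma-algebra it generates. *)
Lemma off_site_indep (i0 : I) (E : set T) (B : set R) :
  <<s off_site i0 >> E -> measurable B ->
  P (E `&` h i0 @^-1` B) = (P E * P (h i0 @^-1` B))%E.
Proof.
move=> GE mB.
have mhB := measurable_RV_preimage (h i0) _ mB.
have pB : 0 <= fine (P (h i0 @^-1` B)) by exact: fine_ge0.
have scaleE A : mscale (NngNum pB) P A = (P A * P (h i0 @^-1` B))%E.
  by rewrite /mscale/= fineK ?fin_num_measure// muleC.
rewrite -scaleE -[LHS]/(mrestr P mhB E).
apply: (g_sigma_algebra_measure_unique (off_site i0)
  (@off_site_measurable i0) (fun=> setT) (fun=> off_site_setT i0)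
  _ _ _ (@off_site_setI i0)) => //.
- by apply/seteqP; split => // x _; exists 0%N.
- move=> _ [F [A [JF mA ->]]].
  rewrite /= [RHS]scaleE /mrestr.
  (* Putting [B] in the slot at [i0] turns the intersection into a rectangle over all sites, where
     independence of the fields applies. *)
  pose A' i := if i == i0 then B else A i.
  have mA' i : measurable (A' i) by rewrite /A'; case: ifP.
  have -> : (F `&` \bigcap_(i in [set` [set~ i0]%SET]) h i @^-1` A i) `&`
      h i0 @^-1` B = F `&` \bigcap_(i in [set` [set: I]%SET]) h i @^-1` A' i.
    rewrite -setIA; congr (_ `&` _); apply/seteqP; split => x /=.
      move=> [Ax Bx] i _; rewrite /= /A'; case: eqP => [->//|/eqP ii0].
      by apply: (Ax i); rewrite /= in_setC1.
    move=> A'x; split.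
      move=> i /=; rewrite in_setC1 => ii0.
      by have /= := A'x i; rewrite /A' (negbTE ii0) finset.in_setT => /(_ isT).
    by have /= := A'x i0; rewrite /A' eqxx finset.in_setT => /(_ isT).
  rewrite !indep_rectangle// (bigD1 i0) ?finset.in_setT//= {1}/A' eqxx.
  rewrite -muleA; congr (_ * _)%E; rewrite muleC; congr (_ * _)%E.
  by apply: eq_big => i; rewrite ?finset.in_setT ?in_setC1// /A' => /negbTE ->.
- move=> _; apply: (@le_lt_trans _ _ 1%E); last exact: ltry.
  by apply: probability_le1; exact: measurableI.
Qed.

End Independence.

(** * The Gibbs expectation for fixed couplings and fields *)

Section Gibbs.
Context {R : realType} {d : nat} {Lam : {fset 'rV[R]_d}}.
Notation config := {ffun Lam -> bool}.
Variables (beta : R) (J : bond Lam -> R) (h : Lam -> R).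
Implicit Types (f g : config -> R) (s : config).
Notation omega := (gibbs beta J h).
Let W s := expR (- beta * hamiltonian J h s).

Lemma partition_function_gt0 : 0 < \sum_s W s.
Proof.
rewrite (bigD1 [ffun=> true])//= ltr_wpDr ?expR_gt0//.
by apply: sumr_ge0 => s _; exact: expR_ge0.
Qed.

Lemma gibbs_ge0 f : (forall s, 0 <= f s) -> 0 <= omega f.
Proof.
move=> f0; apply: divr_ge0; last exact: ltW partition_function_gt0.
by apply: sumr_ge0 => s _; rewrite mulr_ge0 ?expR_ge0.
Qed.

Lemma gibbs_lin (a : R) f g :
  omega (fun s => a * f s + g s) = a * omega f + omega g.
Proof.
rewrite /gibbs mulrA -mulrDl mulr_sumr -big_split/=; congr (_ / _).
by apply: eq_bigr => s _; ring.
Qed.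

Lemma gibbs1 : omega (fun=> 1) = 1.
Proof.
rewrite /gibbs; under eq_bigr do rewrite mul1r.
by rewrite divff// gt_eqF// partition_function_gt0.
Qed.

Lemma gibbs_spin_product_sqr m n :
  omega (spin^~ m) ^+ 2 + omega (spin^~ n) ^+ 2 <=
  1 + omega (fun s => spin s m * spin s n) ^+ 2.
Proof.
set p := omega _; set q := omega _; set r := omega _.
have spinE (a b : R) : omega (fun s => (1 + a * spin s m) * (1 + b * spin s n))
    = 1 + a * p + b * q + a * b * r.
  rewrite (_ : (fun s => _) = (fun s => a * spin s m +
      (b * spin s n + (a * b * (spin s m * spin s n) + 1)))); last first.
    by apply/funext => s; ring.
  by rewrite !gibbs_lin gibbs1 -/p -/q -/r; ring.
have spin_ge0 (a b : R) : `|a| = 1 -> `|b| = 1 ->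
    0 <= 1 + a * p + b * q + a * b * r.
  move=> a1 b1; rewrite -spinE; apply: gibbs_ge0 => s.
  have spin01 (c : R) i : `|c| = 1 -> 0 <= 1 + c * spin s i.
    move=> c1; rewrite -lerBlDl sub0r.
    have -> : 1 = `|c * spin s i|.
      by rewrite normrM c1 mul1r /spin; case: ifP; rewrite ?normrN normr1.
    by rewrite lerNl -normrN ler_norm.
  by rewrite mulr_ge0 ?spin01.
have n1 : `|1 : R| = 1 by rewrite normr1.
have nN1 : `|-1 : R| = 1 by rewrite normrN1.
(* [H1] and [H2] bound the absolute value of [p + q] by [1 + r]; [H3] and [H4] bound that of [p - q]
   by [1 - r]. The squared inequalities add up to twice the claim. *)
have H1 := spin_ge0 _ _ n1 n1; have H2 := spin_ge0 _ _ nN1 nN1.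
have H3 := spin_ge0 _ _ n1 nN1; have H4 := spin_ge0 _ _ nN1 n1.
have : (p + q) ^+ 2 <= (1 + r) ^+ 2.
  by rewrite -subr_ge0 subr_sqr mulr_ge0//; lra.
have : (p - q) ^+ 2 <= (1 - r) ^+ 2.
  by rewrite -subr_ge0 subr_sqr mulr_ge0//; lra.
by lra.
Qed.

(** The field at [m] is set to 0 instead of removing the site, so [hamiltonian] still applies on the
    same [Lam]. *)
Definition field_off (m : Lam) : Lam -> R := fun i => if i == m then 0 else h i.

Lemma hamiltonian_off m s :
  hamiltonian J h s = hamiltonian J (field_off m) s - h m * spin s m.
Proof.
rewrite /hamiltonian -[RHS]addrA -[in RHS]opprD; congr (_ - _).
rewrite (bigD1 m)//= [in RHS](bigD1 m)//= {1}/field_off eqxx mul0r add0r addrC.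
by congr (_ + _); apply: eq_bigr => i /negbTE im; rewrite /field_off im.
Qed.

(** The partition function restricted to one value of the spin at [m], with the field there switched
    off. *)
Definition off_weight (m : Lam) (b : bool) : R :=
  \sum_(s : config | s m == b) expR (- beta * hamiltonian J (field_off m) s).

(** This is [- 2 * c] for the [c] such that the mean spin at [m] is [tanh (beta * h m + c)]. *)
Definition off_log_odds m : R := ln (off_weight m false / off_weight m true).

Lemma off_weight_gt0 m b : 0 < off_weight m b.
Proof.
rewrite /off_weight (bigD1 [ffun=> b])/= ?ffunE// ltr_wpDr ?expR_gt0//.
by apply: sumr_ge0 => s _; exact: expR_ge0.
Qed.

(** With off-weights [a] for spin 1 and [b] for spin -1, and [e = expR (beta * h m)], the mean spin
    is [(a * e - b / e) / (a * e + b / e)]. One minus its square is [4 * u / (1 + u) ^+ 2] for the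
    odds [u = b / (a * e ^+ 2)]. *)
Lemma gibbs_spin_variance m : 1 - omega (spin^~ m) ^+ 2 =
  logistic_variance R (off_log_odds m - 2 * beta * h m).
Proof.
have WE s : expR (- beta * hamiltonian J h s) =
    expR (- beta * hamiltonian J (field_off m) s) *
    expR (beta * h m * spin s m).
  by rewrite (hamiltonian_off m) -expRD; congr expR; ring.
have sumE (f : config -> R) (x y : R) :
  (forall s, f s = if s m then x else y) ->
  \sum_s f s * expR (- beta * hamiltonian J h s) =
    x * (off_weight m true * expR (beta * h m)) +
    y * (off_weight m false * expR (- (beta * h m))).
  move=> fE; rewrite (bigID (fun s : config => s m))/=.
  rewrite !mulr_suml !mulr_sumr; congr (_ + _); apply: eq_big => s.
  - by rewrite eqb_id.
  - by move=> sm; rewrite WE fE /spin sm mulr1.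
  - by rewrite eqbF_neg.
  - by move=> /negbTE sm; rewrite WE fE /spin sm mulrN1.
have ZE : \sum_s expR (- beta * hamiltonian J h s) =
    off_weight m true * expR (beta * h m) +
    off_weight m false * expR (- (beta * h m)).
  under eq_bigr do rewrite -[expR _]mul1r.
  by rewrite (sumE (fun=> 1) 1 1) ?mul1r// => s; case: ifP.
rewrite /gibbs ZE (sumE _ 1 (-1))// /logistic_variance expRB lnK; last first.
  by rewrite posrE divr_gt0// off_weight_gt0.
rewrite (_ : 2 * beta * h m = beta * h m + beta * h m); last by ring.
rewrite expRD expRN.
have := off_weight_gt0 m true; have := off_weight_gt0 m false.
have := expR_gt0 (beta * h m).
move: (expR _) (off_weight _ _) (off_weight _ _) => e b a e0 b0 a0.
field; rewrite ?gt_eqF ?addr_gt0 ?mulr_gt0//.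
Qed.

End Gibbs.

(** * Measurability in the disorder, for an arbitrary sigma-algebra on the sample space *)

Section GibbsMeasurability.
Context {R : realType} {d : nat} {Lam : {fset 'rV[R]_d}}.
Context {disp : measure_display} {T : measurableType disp}.
Variables (beta : R) (J : bond Lam -> T -> R).
Implicit Types h : Lam -> T -> R.
Hypothesis mJ : forall e, measurable_fun setT (J e).

Lemma measurable_funV_gt0 (f : T -> R) :
  measurable_fun setT f -> (forall w, 0 < f w) ->
  measurable_fun setT (fun w => (f w)^-1).
Proof.
(* Positivity allows the inverse to be written as [expR (- ln (f w))], a composition of measurable
   functions. *)
move=> mf f0; under eq_fun => w do rewrite -(lnK (f0 w)) -expRN.
by do 2 apply: measurableT_comp => //; apply: measurableT_comp => //.
Qed.

Lemma measurable_hamiltonian h s : (forall i, measurable_fun setT (h i)) ->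
  measurable_fun setT (fun w => hamiltonian (J^~ w) (h^~ w) s).
Proof.
move=> mh; apply: measurable_funB.
  apply: measurableT_comp => //; apply: measurable_sum => e.
  by apply: measurable_funM => //; exact: mJ.
by apply: measurable_sum => i; apply: measurable_funM => //; exact: mh.
Qed.

Lemma measurable_gibbs h (f : {ffun Lam -> bool} -> R) :
  (forall i, measurable_fun setT (h i)) ->
  measurable_fun setT (fun w => gibbs beta (J^~ w) (h^~ w) f).
Proof.
move=> mh.
have mW s : measurable_fun setT
    (fun w => expR (- beta * hamiltonian (J^~ w) (h^~ w) s)).
  apply: measurableT_comp => //; apply: measurable_funM => //.
  exact: measurable_hamiltonian.
apply: measurable_funM.
  by apply: measurable_sum => s; exact: measurable_funM.
apply: measurable_funV_gt0 => [|w]; first exact: measurable_sum.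
exact: partition_function_gt0.
Qed.

(** Measurability is asked only of the fields away from [m], so that the lemma also applies to the
    sigma-algebra generated by [off_site]. *)
Lemma measurable_off_log_odds h m :
  (forall i, i != m -> measurable_fun setT (h i)) ->
  measurable_fun setT (fun w => off_log_odds beta (J^~ w) (h^~ w) m).
Proof.
move=> mh.
have mW b : measurable_fun setT (fun w => off_weight beta (J^~ w) (h^~ w) m b).
  rewrite /off_weight; under eq_fun do rewrite -big_filter.
  apply: measurable_sum => s.
  apply: measurableT_comp => //; apply: measurable_funM => //.
  apply: (measurable_hamiltonian (fun i w => if i == m then 0 else h i w)) => i.
  by case: (eqVneq i m) => // /mh.
apply: measurableT_comp; first exact: measurable_ln.
apply: measurable_funM => //; apply: measurable_funV_gt0 => // w.
exact: off_weight_gt0.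
Qed.
End GibbsMeasurability.

(** * The averaged variance of a single spin *)

Section SiteBound.
Context {R : realType} {d : nat} {Lam : {fset 'rV[R]_d}}.
Context {disp : measure_display} {T : measurableType disp}.
Context {P : probability T R}.
Variables (beta Gamma : R).
Variables (J : bond Lam -> {RV P >-> R}) (h : Lam -> {RV P >-> R}).
Hypotheses (beta_gt0 : 0 < beta) (Gamma_gt0 : 0 < Gamma).
Hypothesis h_gauss : forall i, centered_gaussian Gamma (h i).
Hypothesis h_indep : mutually_independent h.
Hypothesis Jh_indep : independent_families J h.

(** Once the log-odds at [m] are frozen, the only randomness left is [h m], which is independent of
    them; the Gaussian bound, uniform in the log-odds, then applies. *)
Lemma site_variance_le (m : Lam) :
  (\int[P]_w (1 - gibbs beta (J^~ w) (h^~ w) (spin^~ m) ^+ 2)%:E <=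
   (normal_peak Gamma * (2 / beta))%:E)%E.
Proof.
have mY : measurable_fun [set: T]
    (fun w => off_log_odds beta (J^~ w) (h^~ w) m).
  by apply: measurable_off_log_odds.
pose Y : {RV P >-> R} := mfun_Sub (mem_set mY).
have mX : measurable_fun [set: T] (h m : T -> measurableTypeR R).
  exact: (measurable_funP (h m)).
(* [normal_prob] is a measure on [measurableTypeR R], whose measurable structure
   is convertible to that of [R] but not syntactically the same. *)
pose X : {RV P >-> measurableTypeR R} :=
  @mfun_Sub _ _ T (measurableTypeR R) (h m) (mem_set mX).
pose g (z : R * measurableTypeR R) :=
  logistic_variance R (z.1 - 2 * beta * z.2).
under eq_integral do rewrite gibbs_spin_variance.
apply: (@ge0_integral_indep_le _ _ _ _ _ _ _ P Y X g).
- move=> A B mA mB; apply: (off_site_indep J h h_indep Jh_indep) => //.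
  rewrite -[_ @^-1` A]setTI.
  (* The preimage of [A] must lie in the off-site sigma-algebra, which is measurability of the
     log-odds for that smaller structure on [T]. *)
  have : measurable_fun [set: g_sigma_algebraType (off_site J h m)]
      (fun w => off_log_odds beta (J^~ w) (h^~ w) m).
    apply: measurable_off_log_odds => [e|i im].
      exact: off_site_measurable_coupling.
    exact: off_site_measurable_field.
  by apply.
- apply: (measurableT_comp (@measurable_logistic_variance R)).
  have m2 : measurable_fun setT (fun z : R * measurableTypeR R => z.2 : R).
    exact: (@measurable_snd _ _ R (measurableTypeR R)).
  by apply: measurable_funB => //; exact: measurable_funM.
- by move=> z; exact: logistic_variance_ge0.
- move=> y; rewrite /g/= (eq_measure_integral (normal_prob 0 Gamma)).
    exact: normal_integral_logistic_variance_le.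
  (* Since [Gamma] is positive, [centered_gaussian] is in its [normal_prob] case. *)
  by move=> A mA _; apply: etrans (h_gauss m A mA) _; rewrite gt_eqF.
Qed.

End SiteBound.

Theorem theorem1 (R : realType) (d : nat)
    (B : 'M[R]_d) (a b : 'rV[int]_d) (Lam : {fset 'rV[R]_d})
    (B_basis : B \in unitmx) (L_spacing : unit_spacing (lattice B))
    (Lam_box : [set` Lam] = lattice_box B a b)
    (disp : measure_display) (T : measurableType disp) (P : probability T R)
    (beta Delta Gamma : R)
    (beta_gt0 : 0 < beta) (Delta_ge0 : 0 <= Delta) (Gamma_gt0 : 0 < Gamma)
    (J : bond Lam -> {RV P >-> R}) (h : Lam -> {RV P >-> R})
    (J_gauss : forall e, centered_gaussian Delta (J e))
    (h_gauss : forall i, centered_gaussian Gamma (h i))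
    (J_indep : mutually_independent J) (h_indep : mutually_independent h)
    (Jh_indep : independent_families J h)
    (m n : Lam) :
  let s1 := 2 / Gamma * Num.sqrt (2 / pi) in
  let s3 := 1 / (Num.sqrt (2 * pi) * Gamma ^+ 3) in
  ((1 - s1 / beta - s3 / beta ^+ 3)%:E <=
   'E_P[(fun w => gibbs beta (fun e => J e w) (fun i => h i w)
                   (fun s => spin s m * spin s n) ^+ 2)%R])%E.
Proof.
cbv zeta.
pose omega w f := gibbs beta (fun e => J e w) (fun i => h i w) f.
have mJ e : measurable_fun setT (J e) by [].
have mh i : measurable_fun setT (h i) by [].
have momega f : measurable_fun setT (omega^~ f).
  exact: (measurable_gibbs beta (fun e => J e) mJ (fun i => h i)).
have mvar k : measurable_fun setT (fun w => (1 - omega w (spin^~ k) ^+ 2)%:E).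
  apply/measurable_EFinP; apply: measurable_funB => //; exact: measurable_funX.
have var_ge0 k w : (0 <= (1 - omega w (spin^~ k) ^+ 2)%:E)%E.
  by rewrite lee_fin /omega gibbs_spin_variance logistic_variance_ge0.
have site := site_variance_le beta Gamma J h beta_gt0 Gamma_gt0 h_gauss
  h_indep Jh_indep.
set K := normal_peak Gamma * (2 / beta).
pose omega2 w : R := omega w (fun s => spin s m * spin s n) ^+ 2.
have momega2 : measurable_fun setT omega2 by exact: measurable_funX.
(* The pointwise inequality between the two spin variances and [omega2] is integrated in additive
   form, so only nonnegative integrands occur. *)
have total : (1 <= 'E_P[omega2] + (K%:E + K%:E))%E.
  rewrite unlock.
  apply: (@le_trans _ _ (\int[P]_w ((omega2 w)%:E +
     ((1 - omega w (spin^~ m) ^+ 2)%:E + (1 - omega w (spin^~ n) ^+ 2)%:E)))%E).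
    rewrite -[leLHS](@probability_setT _ _ _ P) -[leLHS]mul1e -integral_cst//.
    apply: ge0_le_integral => //.
    - apply: emeasurable_funD; last exact: emeasurable_funD.
      exact/measurable_EFinP.
    - move=> w _; rewrite -!EFinD lee_fin.
      have := gibbs_spin_product_sqr beta (fun e => J e w) (fun i => h i w) m n.
      by rewrite -!/(omega w _) -/(omega2 w); lra.
  rewrite ge0_integralD//; first last.
  - exact: emeasurable_funD.
  - by move=> w _; rewrite adde_ge0.
  - exact/measurable_EFinP.
  - by move=> w _; rewrite lee_fin sqr_ge0.
  by rewrite leeD2l// ge0_integralD// leeD// site.
have pi2 : 0 < Num.sqrt (2 * pi : R) by rewrite sqrtr_gt0 mulr_gt0// pi_gt0.
(* Each site contributes exactly half of [s1 / beta]. Writing [2 / pi] as [2 ^+ 2 / (2 * pi)] brings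
   both sides to the same square root. *)
have KE : 2 / Gamma * Num.sqrt (2 / pi) / beta = K + K.
  have -> : Num.sqrt (2 / pi : R) = 2 / Num.sqrt (2 * pi).
    have -> : 2 / pi = 2 ^+ 2 / (2 * pi) :> R
      by rewrite expr2 invfM mulrA mulfK.
    rewrite sqrtrM ?sqr_ge0// sqrtr_sqr ger0_norm//.
    by rewrite sqrtrV// mulr_ge0// pi_ge0.
  rewrite /K /normal_peak -mulrnAr (sqrtrM _ (sqr_ge0 Gamma)) sqrtr_sqr.
  rewrite gtr0_norm//.
  rewrite -(mulr_natl pi); move: pi2; move: (Num.sqrt _) => q q0.
  by field; rewrite !gt_eqF.
apply: (@le_trans _ _ (1 - (K%:E + K%:E))%E); last by rewrite leeBlDr.
(* The bound obtained exceeds the stated one by [s3 / beta ^+ 3], whose nonnegativity is all that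
   remains. *)
rewrite -!EFinD lee_fin KE gerDl oppr_le0.
by rewrite !divr_ge0 ?mulr_ge0 ?exprn_ge0 ?sqrtr_ge0 ?ltW.
Qed.
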